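(* Let $H=\mathsf Q(2,\beta)$ and let $A\subset H$ be the subalgebra generated by $\mathsf K,\mathsf f_1^+,\mathsf f_1^-$. Let $P_0^+(A)$ be the projective cover of the trivial $A$-module (the tensor unit), and for $\mu\in\mathrm{Mat}_2(\mathbb C)$ let $P_\mu$ be the $H$-module described in the context. Then every lift of $P_0^+(A)$ to an $H$-module is of the form $P_\mu$ for some $\mu\in\mathrm{Mat}_2(\mathbb C)$. Moreover, $P_\mu\cong P_{\mu'}$ as $H$-modules if and only if $\mu=\mu'$.
   Context: As a unital $\mathbb C$-algebra, $H=\mathsf Q(2,\beta)$ (independently of $\beta$, $\beta^4=1$) is generated by $\mathsf{K},\mathsf{f}_1^\pm,\mathsf f_2^\pm$ with relations, for $\boldsymbol e_1=\frac12(1-\mathsf K^2)$: $\mathsf f_i^\pm\mathsf K=-\mathsf K\mathsf f_i^\pm$, $\mathsf f_i^+\mathsf f_j^-+\mathsf f_j^-\mathsf f_i^+=\delta_{ij}\boldsymbol e_1$, $\mathsf f_i^\pm\mathsf f_j^\pm+\mathsf f_j^\pm\mathsf f_i^\pm=0$, $\mathsf K^4=1$. It has dimension $2^6$, and $A$ has dimension $2^4$. The trivial $A$-module is $\mathbb C$ with $\mathsf K=1$ and $\mathsf f_1^\pm=0$. $P_0^+(A)$ is four-dimensional with basis $v_0$, $\mathsf f_1^+v_0$, $\mathsf f_1^-v_0$, $\mathsf f_1^+\mathsf f_1^-v_0$, where $\mathsf Kv_0=v_0$. An $A$-module $M$ lifts to the $H$-module $N$ (and $N$ is a lift of $M$)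 if the restriction of $N$ to $A$ is isomorphic to $M$ as an $A$-module. For $\mu=\begin{pmatrix} a^- & a^+ \\ b^- & b^+ \end{pmatrix}$, $P_\mu$ is the $H$-module with underlying $A$-module $P_0^+(A)$ on which $\mathsf f_2^\varepsilon$ acts as $a^\varepsilon\mathsf f_1^-+b^\varepsilon\mathsf f_1^+$, $\varepsilon=\pm$. ''Of the form $P_\mu$'' means isomorphic to $P_\mu$ as an $H$-module. *)

(* Defs.v *)
From HB Require Import structures.
From mathcomp Require Import all_boot all_order all_algebra generic_quotient.
From mathcomp Require Import boolp classical_sets reals complex.

Set Implicit Arguments.
Unset Strict Implicit.
Unset Printing Implicit Defensive.

Import GRing.Theory Num.Theory.

Local Open Scope ring_scope.
Local Open Scope quotient_scope.
Local Open Scope complex_scope.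

(** * Modules over a ring *)

Definition isomorphic (B : pzRingType) (M N : lmodType B) : Prop :=
  exists f : {linear M -> N}, bijective f.

Definition projective (B : pzRingType) (P : lmodType B) : Prop :=
  forall (X Y : lmodType B) (g : {linear X -> Y}) (f : {linear P -> Y}),
    (forall y, exists x, g x = y) ->
    exists h : {linear P -> X}, forall x, g (h x) = f x.

(* The last condition says that the kernel of p is superfluous: a submodule S
   with S + ker p = P is all of P. *)
Definition projective_cover (B : pzRingType) (P M : lmodType B)
    (p : {linear P -> M}) : Prop :=
  [/\ projective P,
      forall y, exists x, p x = y &
      forall S : {pred P}, submod_closed S ->
        (forall x, exists2 s, s \in S & p (x - s) = 0) ->
        forall x, x \in S].

(** * The algebra Q(2, beta)

The parameter beta enters only the coalgebra structure and the coassociator,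
so that it does not occur in the algebra defined below. *)

Section SymplecticFermions.

Variable R : realType.
Local Notation C := R[i].

(* [Genf i s] stands for f_{i+1}^+ if s = true, and for f_{i+1}^- otherwise. *)
Variant gen : Type := GenK | Genf of 'I_2 & bool.

Inductive expr : Type :=
  | Gen of gen
  | Cst of C
  | Add of expr & expr
  | Mul of expr & expr.

Declare Scope expr_scope.
Local Delimit Scope expr_scope with X.
Local Notation "s + t" := (Add s t) : expr_scope.
Local Notation "s * t" := (Mul s t) : expr_scope.
Local Notation "- t" := (Mul (Cst (-1)) t) : expr_scope.
Local Notation tK := (Gen GenK).
Local Notation tf i s := (Gen (Genf i s)).

Definition te1 : expr := (Cst 2^-1 * (Cst 1 + - (tK * tK)))%X.

Inductive defining_relation : expr -> expr -> Prop :=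
  | rel_fK i s : defining_relation (tf i s * tK)%X (- (tK * tf i s))%X
  | rel_fpm i j :
      defining_relation (tf i true * tf j false + tf j false * tf i true)%X
               (Cst (i == j)%:R * te1)%X
  | rel_ff i j s :
      defining_relation (tf i s * tf j s + tf j s * tf i s)%X (Cst 0)
  | rel_K4 : defining_relation (tK * tK * tK * tK)%X (Cst 1).

(* The congruence on expressions generated by the axioms of unital C-algebras and by
   the defining relations. *)
Inductive cong : expr -> expr -> Prop :=
  | cong_rel s t : defining_relation s t -> cong s t
  | cong_refl t : cong t t
  | cong_sym s t : cong s t -> cong t s
  | cong_trans s t u : cong s t -> cong t u -> cong s u
  | cong_add s s' t t' : cong s s' -> cong t t' -> cong (s + t)%X (s' + t')%X
  | cong_mul s s' t t' : cong s s' -> cong t t' -> cong (s * t)%X (s' * t')%X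
  | cong_addA s t u : cong (s + (t + u))%X (s + t + u)%X
  | cong_addC s t : cong (s + t)%X (t + s)%X
  | cong_add0 t : cong (Cst 0 + t)%X t
  | cong_mulA s t u : cong (s * (t * u))%X (s * t * u)%X
  | cong_mul1 t : cong (Cst 1 * t)%X t
  | cong_mul0 t : cong (Cst 0 * t)%X (Cst 0)
  | cong_mulDl s t u : cong ((s + t) * u)%X (s * u + t * u)%X
  | cong_mulDr s t u : cong (s * (t + u))%X (s * t + s * u)%X
  | cong_cstD a b : cong (Cst (a + b)) (Cst a + Cst b)%X
  | cong_cstM a b : cong (Cst (a * b)) (Cst a * Cst b)%X
  | cong_cstC a t : cong (t * Cst a)%X (Cst a * t)%X.

Fixpoint act (V : lmodType C) (op : gen -> {linear V -> V}) (t : expr) (v : V)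
    : V :=
  match t with
  | Gen g => op g v
  | Cst c => c *: v
  | Add s u => act op s v + act op u v
  | Mul s u => act op s (act op u v)
  end.

Definition respects (V : lmodType C) (op : gen -> {linear V -> V}) : Prop :=
  forall s t, defining_relation s t -> act op s =1 act op t.

Section Act.
Variables (V : lmodType C) (op : gen -> {linear V -> V}).

Lemma actD t : {morph act op t : v w / v + w}.
Proof.
elim: t => [g|c|s IHs u IHu|s IHs u IHu] v w /=.
- exact: linearD.
- exact: scalerDr.
- by rewrite IHs IHu addrACA.
- by rewrite IHu IHs.
Qed.

Lemma actZ t c v : act op t (c *: v) = c *: act op t v.
Proof.
elim: t v => [g|d|s IHs u IHu|s IHs u IHu] v /=.
- exact: linearZ.
- by rewrite !scalerA mulrC.
- by rewrite IHs IHu scalerDr.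
- by rewrite IHu IHs.
Qed.

Hypothesis opP : respects op.

Lemma act_cong s t : cong s t -> act op s =1 act op t.
Proof.
elim=> {s t} /=.
- exact: opP.
- by [].
- by move=> s t _ IH v.
- by move=> s t u _ IH1 _ IH2 v; rewrite IH1.
- by move=> s s' t t' _ IH1 _ IH2 v; rewrite IH1 IH2.
- by move=> s s' t t' _ IH1 _ IH2 v; rewrite IH2 IH1.
- by move=> s t u v; rewrite addrA.
- by move=> s t v; rewrite addrC.
- by move=> t v; rewrite scale0r add0r.
- by [].
- by move=> t v; rewrite scale1r.
- by move=> t v; rewrite !scale0r.
- by [].
- by move=> s t u v; rewrite actD.
- by move=> a b v; rewrite scalerDl.
- by move=> a b v; rewrite scalerA.
- by move=> a t v; rewrite actZ.
Qed.

End Act.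

HB.instance Definition _ := gen_eqMixin expr.
HB.instance Definition _ := gen_choiceMixin expr.

Definition congb (s t : expr) : bool := `[< cong s t >].

Lemma congb_equiv : equiv_class_of congb.
Proof.
split=> [t|s t|t s u].
- exact/asboolP/cong_refl.
- by apply/asboolP/asboolP; apply: cong_sym.
- by move=> /asboolP st /asboolP tu; apply/asboolP/(cong_trans st).
Qed.

Canonical cong_equiv := EquivRelPack congb_equiv.

Definition Q2 : Type := {eq_quot cong_equiv}.
HB.instance Definition _ := Choice.on Q2.

Definition cls (t : expr) : Q2 := \pi_({eq_quot cong_equiv}) t.
Definition rep (x : Q2) : expr := repr (x : {eq_quot cong_equiv}).

Lemma repK : cancel rep cls. Proof. exact: reprK. Qed.

Lemma clsP s t : cls s = cls t <-> cong s t.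
Proof.
split=> [/eqquotP /asboolP //|st].
by apply/eqquotP/asboolP.
Qed.

Lemma repP t : cong (rep (cls t)) t. Proof. by apply/clsP; rewrite repK. Qed.

Definition Q2_add (x y : Q2) : Q2 := cls (rep x + rep y)%X.
Definition Q2_mul (x y : Q2) : Q2 := cls (rep x * rep y)%X.
Definition Q2_opp (x : Q2) : Q2 := cls (- rep x)%X.
Definition Q2_scale (c : C) (x : Q2) : Q2 := cls (Cst c * rep x)%X.

Lemma Q2_addE s t : Q2_add (cls s) (cls t) = cls (s + t)%X.
Proof. by apply/clsP/cong_add; apply: repP. Qed.
Lemma Q2_mulE s t : Q2_mul (cls s) (cls t) = cls (s * t)%X.
Proof. by apply/clsP/cong_mul; apply: repP. Qed.
Lemma Q2_oppE t : Q2_opp (cls t) = cls (- t)%X.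
Proof. by apply/clsP/cong_mul; [apply: cong_refl|apply: repP]. Qed.
Lemma Q2_scaleE c t : Q2_scale c (cls t) = cls (Cst c * t)%X.
Proof. by apply/clsP/cong_mul; [apply: cong_refl|apply: repP]. Qed.

Let Q2E := (Q2_addE, Q2_mulE, Q2_oppE, Q2_scaleE).

Lemma Q2_addA : associative Q2_add.
Proof.
by move=> x y z; rewrite -(repK x) -(repK y) -(repK z) !Q2E; apply/clsP/cong_addA.
Qed.
Lemma Q2_addC : commutative Q2_add.
Proof. by move=> x y; rewrite -(repK x) -(repK y) !Q2E; apply/clsP/cong_addC. Qed.
Lemma Q2_add0 : left_id (cls (Cst 0)) Q2_add.
Proof. by move=> x; rewrite -(repK x) !Q2E; apply/clsP/cong_add0. Qed.
Lemma Q2_addN : left_inverse (cls (Cst 0)) Q2_opp Q2_add.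
Proof.
move=> x; rewrite -(repK x) !Q2E; apply/clsP.
set t := rep x.
apply: (@cong_trans _ (- t + Cst 1 * t)%X).
  by apply: cong_add; [apply: cong_refl|apply/cong_sym/cong_mul1].
apply: cong_trans (cong_sym (cong_mulDl _ _ _)) _.
apply: cong_trans (cong_mul0 t).
apply: cong_mul (cong_refl _); apply: cong_sym.
by rewrite -[X in Cst X](addNr 1); apply: cong_cstD.
Qed.

HB.instance Definition _ :=
  GRing.isZmodule.Build Q2 Q2_addA Q2_addC Q2_add0 Q2_addN.

Lemma Q2_mulA : associative Q2_mul.
Proof.
by move=> x y z; rewrite -(repK x) -(repK y) -(repK z) !Q2E; apply/clsP/cong_mulA.
Qed.
Lemma Q2_mul1 : left_id (cls (Cst 1)) Q2_mul.
Proof. by move=> x; rewrite -(repK x) !Q2E; apply/clsP/cong_mul1. Qed.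
Lemma Q2_mulr1 : right_id (cls (Cst 1)) Q2_mul.
Proof.
move=> x; rewrite -(repK x) !Q2E; apply/clsP.
exact: cong_trans (cong_cstC _ _) (cong_mul1 _).
Qed.
Lemma Q2_mulDl : left_distributive Q2_mul Q2_add.
Proof.
by move=> x y z; rewrite -(repK x) -(repK y) -(repK z) !Q2E; apply/clsP/cong_mulDl.
Qed.
Lemma Q2_mulDr : right_distributive Q2_mul Q2_add.
Proof.
by move=> x y z; rewrite -(repK x) -(repK y) -(repK z) !Q2E; apply/clsP/cong_mulDr.
Qed.

Definition triv_op (g : gen) : {linear C^o -> C^o} :=
  match g with GenK => idfun | Genf _ _ => \0 end.

Lemma triv_respects : respects triv_op.
Proof.
move=> s t [i a|i j|i j a|] v /=.
- by rewrite scaler0.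
- by rewrite !scale1r scaleN1r subrr !scaler0 addr0.
- by rewrite addr0 scale0r.
- by rewrite scale1r.
Qed.

Lemma Q2_oner_neq0 : cls (Cst 1) != cls (Cst 0).
Proof.
apply/eqP => /clsP /(act_cong triv_respects) /(_ 1) /=.
by rewrite scale0r scale1r => /eqP; rewrite oner_eq0.
Qed.

HB.instance Definition _ := GRing.Zmodule_isNzRing.Build Q2
  Q2_mulA Q2_mul1 Q2_mulr1 Q2_mulDl Q2_mulDr Q2_oner_neq0.

Lemma Q2_scaleA a b v : Q2_scale a (Q2_scale b v) = Q2_scale (a * b) v.
Proof.
rewrite -(repK v) !Q2E; apply/clsP.
apply: cong_trans (cong_mulA _ _ _) (cong_mul _ (cong_refl _)).
exact/cong_sym/cong_cstM.
Qed.
Lemma Q2_scale1 : left_id 1 Q2_scale.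
Proof. by move=> x; rewrite -(repK x) !Q2E; apply/clsP/cong_mul1. Qed.
Lemma Q2_scaleDr : right_distributive Q2_scale +%R.
Proof.
move=> c x y; rewrite -(repK x) -(repK y) /GRing.add /= !Q2E.
exact/clsP/cong_mulDr.
Qed.
Lemma Q2_scaleDl v : {morph Q2_scale^~ v : a b / a + b}.
Proof.
move=> a b; rewrite -(repK v) [RHS]/GRing.add /= !Q2E; apply/clsP.
exact: cong_trans (cong_mul (cong_cstD _ _) (cong_refl _)) (cong_mulDl _ _ _).
Qed.

HB.instance Definition _ := GRing.Zmodule_isLmodule.Build C Q2
  Q2_scaleA Q2_scale1 Q2_scaleDr Q2_scaleDl.

Lemma Q2_scaleAl (a : C) (u v : Q2) : a *: (u * v) = (a *: u) * v.
Proof.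
rewrite -(repK u) -(repK v) /GRing.scale /GRing.mul /= !Q2E.
exact/clsP/cong_mulA.
Qed.

HB.instance Definition _ := GRing.Lmodule_isLalgebra.Build C Q2 Q2_scaleAl.

Lemma Q2_scaleAr (a : C) (u v : Q2) : a *: (u * v) = u * (a *: v).
Proof.
rewrite -(repK u) -(repK v) /GRing.scale /GRing.mul /= !Q2E; apply/clsP.
apply: cong_trans (cong_mulA _ _ _) _.
apply: cong_trans (cong_sym (cong_mulA _ _ _)).
apply: cong_mul (cong_refl _); exact/cong_sym/cong_cstC.
Qed.

HB.instance Definition _ := GRing.Lalgebra_isAlgebra.Build C Q2 Q2_scaleAr.

Definition Q2_K : Q2 := cls tK.
Definition Q2_f (i : 'I_2) (s : bool) : Q2 := cls (tf i s).
Definition Q2_e1 : Q2 := 2^-1 *: (1 - Q2_K ^+ 2).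

Lemma clsD s t : cls (s + t)%X = cls s + cls t.
Proof. by rewrite /GRing.add /= Q2E. Qed.
Lemma clsM s t : cls (s * t)%X = cls s * cls t.
Proof. by rewrite /GRing.mul /= Q2E. Qed.
Lemma cls_cst c : cls (Cst c) = c%:A.
Proof.
rewrite /GRing.scale /= /GRing.one /= Q2E; apply/clsP/cong_sym.
exact: cong_trans (cong_sym (cong_cstC _ _)) (cong_mul1 _).
Qed.
Lemma cls_e1 : cls te1 = Q2_e1.
Proof.
by rewrite !(clsM, clsD, cls_cst) -/Q2_K /Q2_e1 expr2 !mulr_algl scale1r scaleN1r.
Qed.

(** ** Q2-modules given by generators and relations *)

Record Q2_repr : Type := Q2Repr {
  carrier : lmodType C;
  repr_op : gen -> {linear carrier -> carrier};
  repr_respects : respects repr_op }.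

Definition Q2_module (r : Q2_repr) : Type := carrier r.
HB.instance Definition _ (r : Q2_repr) := GRing.Zmodule.on (Q2_module r).

Section Q2Module.
Variable r : Q2_repr.

Definition Q2_act (x : Q2) (v : Q2_module r) : Q2_module r :=
  act (@repr_op r) (rep x) v.

Lemma Q2_actE t v : Q2_act (cls t) v = act (@repr_op r) t v.
Proof. exact: (act_cong (@repr_respects r) (repP t)). Qed.

Lemma Q2_actA a b v : Q2_act a (Q2_act b v) = Q2_act (a * b) v.
Proof. by rewrite -(repK a) -(repK b) -clsM !Q2_actE. Qed.
Lemma Q2_act1 : left_id 1 Q2_act.
Proof. by move=> v; rewrite [1]/(cls (Cst 1)) Q2_actE /= scale1r. Qed.
Lemma Q2_actDr : right_distributive Q2_act +%R.
Proof. by move=> a v w; apply: actD. Qed.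
Lemma Q2_actDl v : {morph Q2_act^~ v : a b / a + b}.
Proof. by move=> a b; rewrite -(repK a) -(repK b) -clsD !Q2_actE. Qed.

HB.instance Definition _ := GRing.Zmodule_isLmodule.Build Q2 (Q2_module r)
  Q2_actA Q2_act1 Q2_actDr Q2_actDl.

Lemma scale_cls t (v : Q2_module r) : cls t *: v = act (@repr_op r) t v.
Proof. exact: Q2_actE. Qed.

End Q2Module.

(* C with K = 1 and f_i^+- = 0 *)
Definition Q2_triv : lmodType Q2 := Q2_module (Q2Repr triv_respects).

(** ** The subalgebra A generated by K, f_1^+, f_1^- *)

Definition A_pred : {pred Q2} := fun x =>
  `[< forall S : {pred Q2}, GRing.subalg_closed S ->
      Q2_K \in S -> (forall s, Q2_f 0 s \in S) -> x \in S >].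

Lemma A_predP x : reflect (forall S : {pred Q2}, GRing.subalg_closed S ->
  Q2_K \in S -> (forall s, Q2_f 0 s \in S) -> x \in S) (x \in A_pred).
Proof. exact: asboolP. Qed.

Lemma A_subalg : GRing.subalg_closed A_pred.
Proof.
split=> [|c x y /A_predP Ax /A_predP Ay|x y /A_predP Ax /A_predP Ay];
  apply/A_predP => S Ssub KS fS; have [S1 SL SM] := Ssub.
- exact: S1.
- by apply: SL; [apply: Ax|apply: Ay].
- by apply: SM; [apply: Ax|apply: Ay].
Qed.

HB.instance Definition _ := GRing.isSubalgClosed.Build C Q2 A_pred
  (GRing.subalg_closed_semi A_subalg).

Record Q2A : Type := MkA { A_val : Q2; A_valP : A_val \in A_pred }.
HB.instance Definition _ := [isSub for A_val].
HB.instance Definition _ := [Choice of Q2A by <:].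
HB.instance Definition _ := [SubChoice_isSubAlgebra of Q2A by <:].

Lemma K_in_A : Q2_K \in A_pred. Proof. by apply/A_predP. Qed.
Lemma f1_in_A s : Q2_f 0 s \in A_pred. Proof. by apply/A_predP. Qed.

Definition A_K : Q2A := MkA K_in_A.
Definition A_f1 (s : bool) : Q2A := MkA (f1_in_A s).

(** ** Restriction and lifts *)

Definition restrict (N : lmodType Q2) : Type := N.

Section Restrict.
Variable N : lmodType Q2.

HB.instance Definition _ := GRing.Zmodule.on (restrict N).

Definition restrict_scale (a : Q2A) (v : restrict N) : restrict N :=
  A_val a *: (v : N).

Lemma restrict_scaleA a b v :
  restrict_scale a (restrict_scale b v) = restrict_scale (a * b) v.
Proof. exact: scalerA. Qed.
Lemma restrict_scale1 : left_id 1 restrict_scale.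
Proof. by move=> v; apply: scale1r. Qed.
Lemma restrict_scaleDr : right_distributive restrict_scale +%R.
Proof. by move=> a v w; apply: scalerDr. Qed.
Lemma restrict_scaleDl v : {morph restrict_scale^~ v : a b / a + b}.
Proof. by move=> a b; apply: scalerDl. Qed.

HB.instance Definition _ := GRing.Zmodule_isLmodule.Build Q2A (restrict N)
  restrict_scaleA restrict_scale1 restrict_scaleDr restrict_scaleDl.

End Restrict.

Definition is_lift (M : lmodType Q2A) (N : lmodType Q2) : Prop :=
  isomorphic (restrict N : lmodType Q2A) M.

Definition A_triv : lmodType Q2A := restrict Q2_triv.

(** ** The modules P_mu *)

(* The complex vector space underlying an A-module. *)
Definition vspc (M : lmodType Q2A) : Type := M.

Section Vspc.
Variable M : lmodType Q2A.

HB.instance Definition _ := GRing.Zmodule.on (vspc M).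

Definition vspc_scale (c : C) (v : vspc M) : vspc M := (c%:A : Q2A) *: (v : M).

Lemma vspc_scaleA a b v : vspc_scale a (vspc_scale b v) = vspc_scale (a * b) v.
Proof. by rewrite /vspc_scale scalerA mulr_algl scalerA. Qed.
Lemma vspc_scale1 : left_id 1 vspc_scale.
Proof. by move=> v; rewrite /vspc_scale !scale1r. Qed.
Lemma vspc_scaleDr : right_distributive vspc_scale +%R.
Proof. by move=> a v w; apply: scalerDr. Qed.
Lemma vspc_scaleDl v : {morph vspc_scale^~ v : a b / a + b}.
Proof. by move=> a b; rewrite /vspc_scale !scalerDl. Qed.

HB.instance Definition _ := GRing.Zmodule_isLmodule.Build C (vspc M)
  vspc_scaleA vspc_scale1 vspc_scaleDr vspc_scaleDl.

Definition A_op (a : Q2A) (v : vspc M) : vspc M := a *: (v : M).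

Lemma A_op_linear a : linear (A_op a).
Proof.
move=> c v w; rewrite /A_op [LHS]scalerDr; congr (_ + _).
change (a *: ((c%:A : Q2A) *: (v : M)) = (c%:A : Q2A) *: (a *: (v : M))).
by rewrite !scalerA mulr_algl mulr_algr.
Qed.
HB.instance Definition _ a :=
  GRing.isLinear.Build C (vspc M) (vspc M) *:%R (A_op a) (A_op_linear a).

(* For mu = ((a^-, a^+), (b^-, b^+)), f_2^s acts as a^s f_1^- + b^s f_1^+. *)
Definition sign_col (s : bool) : 'I_2 := if s then 1 else 0.

Definition mu_op (mu : 'M[C]_2) (g : gen) : {linear vspc M -> vspc M} :=
  match g with
  | GenK => A_op A_K
  | Genf i s =>
      A_op (if i == 0 then A_f1 s
            else mu 0 (sign_col s) *: A_f1 false + mu 1 (sign_col s) *: A_f1 true)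
  end.

End Vspc.

Definition A_e1 : Q2A := 2^-1 *: (1 - A_K ^+ 2).

Lemma clsR s t : defining_relation s t -> cls s = cls t.
Proof. by move=> st; apply/clsP/cong_rel. Qed.

Lemma Q2_fK i s : Q2_f i s * Q2_K = - (Q2_K * Q2_f i s).
Proof.
rewrite -!clsM (clsR (rel_fK _ _)).
by rewrite clsM cls_cst scaleN1r mulN1r.
Qed.

Lemma Q2_fpm i j : Q2_f i true * Q2_f j false + Q2_f j false * Q2_f i true =
  (i == j)%:R *: Q2_e1.
Proof.
rewrite -!clsM -clsD (clsR (rel_fpm _ _)).
by rewrite clsM cls_cst cls_e1 mulr_algl.
Qed.

Lemma Q2_ff i j s : Q2_f i s * Q2_f j s + Q2_f j s * Q2_f i s = 0.
Proof.
rewrite -!clsM -clsD (clsR (rel_ff _ _ _)).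
by rewrite cls_cst scale0r.
Qed.

Lemma Q2_K4 : Q2_K ^+ 4 = 1.
Proof.
rewrite !exprSr expr0 mul1r /Q2_K -!clsM (clsR rel_K4).
by rewrite cls_cst scale1r.
Qed.

Lemma A_fK s : A_f1 s * A_K = - (A_K * A_f1 s).
Proof. by apply: val_inj; apply: Q2_fK. Qed.

Lemma A_ff s t : A_f1 s * A_f1 t + A_f1 t * A_f1 s = (s != t)%:R *: A_e1.
Proof.
apply: val_inj; case: s; case: t => /=; rewrite ?scale0r ?Q2_ff //.
  by rewrite Q2_fpm.
by rewrite addrC Q2_fpm.
Qed.

Lemma A_K4 : A_K ^+ 4 = 1.
Proof. by apply: val_inj; rewrite rmorphXn; apply: Q2_K4. Qed.

Lemma A_e1_idem : A_e1 * A_e1 = A_e1.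
Proof.
rewrite /A_e1 -scalerAl -scalerAr; congr (_ *: _).
have -> : (1 - A_K ^+ 2) * (1 - A_K ^+ 2) = 2 *: (1 - A_K ^+ 2).
  rewrite mulrBr mulr1 mulrBl mul1r -exprD A_K4 opprB.
  by rewrite scaler_nat mulr2n.
by rewrite scalerA mulVf ?scale1r // pnatr_eq0.
Qed.

Lemma A_ind (S : {pred Q2A}) : GRing.subalg_closed S ->
  A_K \in S -> (forall s, A_f1 s \in S) -> forall a, a \in S.
Proof.
move=> [S1 SL SM] SK Sf [x Ax].
pose T : {pred Q2} := fun y => `[< forall h : y \in A_pred, MkA h \in S >].
have TP y : reflect (forall h : y \in A_pred, MkA h \in S) (y \in T).
  exact: asboolP.
pose T' : {pred Q2} := [predI A_pred & T].
suff /(_ x Ax) /andP[_ /TP] : forall y, y \in A_pred -> y \in T' by apply.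
have [A1 AL AM] := A_subalg.
move=> y /A_predP; apply.
- split.
  + rewrite inE A1; apply/TP => h.
    by have -> : MkA h = 1 by apply: val_inj.
  + move=> c u v /andP[Au /TP Su] /andP[Av /TP Sv].
    rewrite inE AL //; apply/TP => h.
    have -> : MkA h = c *: MkA Au + MkA Av by apply: val_inj.
    by apply: SL; [apply: Su|apply: Sv].
  + move=> u v /andP[Au /TP Su] /andP[Av /TP Sv].
    rewrite inE AM //; apply/TP => h.
    have -> : MkA h = MkA Au * MkA Av by apply: val_inj.
    by apply: SM; [apply: Su|apply: Sv].
- rewrite inE K_in_A; apply/TP => h.
  by have -> : MkA h = A_K by apply: val_inj.
- move=> s; rewrite inE f1_in_A; apply/TP => h.
  by have -> : MkA h = A_f1 s by apply: val_inj.
Qed.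

Lemma A_e1_comm a : A_e1 * a = a * A_e1.
Proof.
pose S : {pred Q2A} := [pred x | A_e1 * x == x * A_e1].
suff /(_ a) /eqP : forall x, x \in S by [].
apply: A_ind => [||s].
- split=> [|c x y /eqP xS /eqP yS|x y /eqP xS /eqP yS]; apply/eqP.
  + by rewrite mul1r mulr1.
  + by rewrite mulrDr mulrDl -(scalerAr c) -(scalerAl c) xS yS.
  + by rewrite mulrA xS -mulrA yS mulrA.
- apply/eqP.
  by rewrite /A_e1 -scalerAl -scalerAr mulrBl mulrBr mul1r mulr1 -exprS -exprSr.
- apply/eqP; rewrite /A_e1 -scalerAl -scalerAr mulrBl mulrBr mul1r mulr1.
  by rewrite expr2 [A_f1 s * _]mulrA A_fK mulNr -[in RHS]mulrA A_fK mulrN opprK mulrA.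
Qed.

Lemma cover_e1 (P : lmodType Q2A) (p : {linear P -> A_triv}) :
  projective_cover p -> forall v : P, A_e1 *: v = 0.
Proof.
move=> [_ _ small].
pose S : {pred P} := [pred x | A_e1 *: x == 0].
suff allS : forall x, x \in S by move=> v; have /eqP := allS v.
apply: small.
  split; first by apply/eqP; rewrite scaler0.
  move=> a u v /eqP uS /eqP vS; apply/eqP.
  by rewrite scalerDr scalerA A_e1_comm -scalerA uS vS scaler0 addr0.
move=> x; exists (x - A_e1 *: x).
  by apply/eqP; rewrite scalerBr scalerA A_e1_idem subrr.
rewrite opprB addrC subrK linearZ /=.
change (Q2_e1 *: (p x : Q2_triv) = 0).
by rewrite -cls_e1 scale_cls /= !(scale1r, scaleN1r) subrr scaler0.
Qed.

Section Pmu.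
Variables (P : lmodType Q2A) (p : {linear P -> A_triv}).
Hypothesis cov : projective_cover p.
Variable mu : 'M[C]_2.

Lemma mu_respects : respects (@mu_op P mu).
Proof.
pose F a b : Q2A := a *: A_f1 false + b *: A_f1 true.
have opF i s : exists a b, @mu_op P mu (Genf i s) =1 @A_op P (F a b).
  rewrite /mu_op; case: eqP => _.
    by exists (~~ s)%:R, s%:R; rewrite /F; case: s;
       rewrite ?scale0r ?scale1r ?add0r ?addr0.
  by eexists _, _ => v.
have e0 (v : P) : A_e1 *: v = 0 by apply: cover_e1 cov v.
have FK a b : F a b * A_K = - (A_K * F a b).
  by rewrite mulrDl mulrDr -!scalerAl -!scalerAr !A_fK opprD !scalerN.
have ff s : A_f1 s * A_f1 s = 0.
  have := A_ff s s; rewrite eqxx scale0r -mulr2n -scaler_nat => /eqP.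
  by rewrite scaler_eq0 pnatr_eq0 => /eqP.
have FF a b c d : F a b * F c d + F c d * F a b = (a * d + b * c) *: A_e1.
  have := A_ff true false; rewrite scale1r => <-.
  rewrite !mulrDl !mulrDr -!scalerAl -!scalerAr !scalerA !ff !scaler0.
  rewrite !(add0r, addr0) (mulrC c) (mulrC d) addrACA addrC.
  by rewrite -!scalerDl (addrC (b * c)) scalerDr.
have opM x y (v : vspc P) : @A_op P x (A_op y v) = @A_op P (x * y) v.
  by rewrite /A_op scalerA.
have opD x y (v : vspc P) : @A_op P x v + @A_op P y v = @A_op P (x + y) v.
  by rewrite /A_op scalerDl.
have opZ c x (v : vspc P) : c *: @A_op P x v = @A_op P (c *: x) v.
  by rewrite -mulr_algl -opM.
have FF0 a b c d v : @A_op P (F a b * F c d + F c d * F a b) v = 0.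
  by rewrite FF -opZ [A_op _ _]e0 scaler0.
have te1_0 v : act (@mu_op P mu) te1 v = 0.
  rewrite -(e0 v) -[RHS]/(@A_op P A_e1 v) /A_e1 -opZ -opD expr2 -scaleN1r -opZ.
  by rewrite -opM /= scale1r [@A_op P 1 v]scale1r.
move=> s t [i e|i j|i j e|] v.
- have [a [b opE]] := opF i e.
  cbn [act]; rewrite !opE -[mu_op _ _ GenK _]/(A_op A_K _) !opM opZ.
  by rewrite FK scaleN1r opM mulNr.
- have [a [b opE]] := opF i true; have [c [d opE']] := opF j false.
  rewrite -[RHS]/(_ *: act (@mu_op P mu) te1 v) te1_0 scaler0.
  by cbn [act]; rewrite !(opE, opE') !opM opD FF0.
- have [a [b opE]] := opF i e; have [c [d opE']] := opF j e.
  by cbn [act]; rewrite !(opE, opE') !opM opD FF0 scale0r.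
- rewrite -[LHS]/(A_op A_K (A_op A_K (A_op A_K (A_op A_K v)))) !opM.
  by rewrite -!expr2 -!exprSr A_K4 -[RHS]/(1 *: v) scale1r [LHS]scale1r.
Qed.

Definition Pmu : lmodType Q2 := Q2_module (Q2Repr mu_respects).

Lemma Pmu_A a (v : Pmu) : A_val a *: v = a *: (v : P) :> P.
Proof.
pose S : {pred Q2A} :=
  fun a => `[< forall v : Pmu, A_val a *: v = a *: (v : P) :> P >].
have SP x : reflect (forall v : Pmu, A_val x *: v = x *: (v : P) :> P) (x \in S).
  exact: asboolP.
have ZA c x (v0 : Pmu) : (c *: x : Q2) *: v0 = c%:A *: (x *: v0).
  by rewrite scalerA mulr_algl.
suff /(_ a) /SP : forall x, x \in S by apply.
apply: A_ind => [||s].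
- split=> [|c x y /SP Sx /SP Sy|x y /SP Sx /SP Sy]; apply/SP => w.
  + by rewrite [A_val 1 *: w]scale1r scale1r.
  + rewrite [LHS]scalerDl [RHS]scalerDl Sy; congr (_ + _).
    rewrite ZA -cls_cst scale_cls /= -[c *: x]mulr_algl -scalerA.
    by congr (_ *: _); apply: Sx.
  + by rewrite -[LHS]scalerA Sy Sx scalerA.
- by apply/SP => w; rewrite [LHS]scale_cls.
- by apply/SP => w; rewrite [LHS]scale_cls.
Qed.

Lemma Pmu_f2 s (v : Pmu) : Q2_f 1 s *: v =
  (mu 0 (sign_col s) *: A_f1 false + mu 1 (sign_col s) *: A_f1 true) *: (v : P).
Proof. exact: scale_cls. Qed.

Lemma Pmu_lift : is_lift P Pmu.
Proof.
pose g (v : restrict Pmu) : P := v.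
have gL : linear g by move=> a v w; congr (_ + _); apply: Pmu_A.
pose gl := GRing.isLinear.Build _ _ _ _ g gL.
exists (HB.pack_for {linear restrict Pmu -> P} g gl).
by exists id.
Qed.

End Pmu.

End SymplecticFermions.

(* Main.v *)
(** The projective cover P is generated by a vector v0 with K v0 = v0, because the
    kernel of p is superfluous, and f_1^+ f_1^- v0 <> 0, as one sees by lifting p to
    an explicit four-dimensional module.  Given a lift of P, f_2^s v0 is
    in the (-1)-eigenspace of K, hence a combination F v0 of f_1^- v0 and f_1^+ v0.
    Since f_2^s and F both anticommute with K and f_1^+-, and since they agree at
    v0, they agree on P.  Conversely, an isomorphism phi from P_mu to P_mu'
    commutes with A, so that comparing phi (f_2^s v0) = f_2^s (phi v0) in terms of
    A gives F_mu v0 = F_mu' v0 by injectivity; applying f_1^+ and f_1^- recovers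
    the coefficients. *)

From HB Require Import structures.
From mathcomp Require Import all_boot all_order all_algebra.
From mathcomp Require Import boolp reals complex ring.
Require Import Defs.

Set Implicit Arguments.
Unset Strict Implicit.
Unset Printing Implicit Defensive.

Import GRing.Theory Num.Theory.

Local Open Scope ring_scope.

Lemma linear_bundle (B : pzRingType) (M N : lmodType B) (g : M -> N) :
  linear g -> exists h : {linear M -> N}, h = g :> (M -> N).
Proof.
move=> gL; pose gl := GRing.isLinear.Build _ _ _ _ g gL.
by exists (HB.pack_for {linear M -> N} g gl).
Qed.

(** * Reduction of closure and linearity statements to generators *)

Section Generators.
Variable R : realType.
Local Notation C := R[i].
Local Notation Q2 := (Q2 R).
Local Notation Q2A := (Q2A R).
Local Notation K := (A_K R).
Local Notation f := (A_f1 R).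

(** Every class has a representing expression, so structural induction on expressions descends to
    the quotient. *)
Lemma Q2_generated (S : Q2 -> Prop) :
  (forall c : C, S c%:A) -> (forall x y, S x -> S y -> S (x + y)) ->
  (forall x y, S x -> S y -> S (x * y)) -> S (Q2_K R) ->
  (forall i s, S (Q2_f R i s)) -> forall x, S x.
Proof.
move=> SC SD SM SK Sf x; rewrite -(repK x).
elim: (rep x) => [[|i s]|c|s Ss t St|s Ss t St] //.
- exact: Sf.
- by rewrite cls_cst.
- by rewrite clsD; apply: SD.
- by rewrite clsM; apply: SM.
Qed.

(** For additive [g], the scalars that commute with [g] are closed under sums and products, so
    [Q2_generated] applies. *)
Lemma Q2_morphism_linear (M N : lmodType Q2) (g : M -> N) :
  {morph g : v w / v + w} -> (forall (c : C) v, g (c%:A *: v) = c%:A *: g v) ->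
  (forall v, g (Q2_K R *: v) = Q2_K R *: g v) ->
  (forall i s v, g (Q2_f R i s *: v) = Q2_f R i s *: g v) ->
  linear g.
Proof.
move=> gD gC gK gf x v w; rewrite gD; congr (_ + _); move: v {w}.
apply: (@Q2_generated (fun x => forall v, g (x *: v) = x *: g v)) => //.
- by move=> y z gy gz v; rewrite !scalerDl gD gy gz.
- by move=> y z gy gz v; rewrite -!scalerA gy gz.
Qed.

(** The elements of [Q2A] that preserve [S] form a subalgebra containing the generators, hence are
    everything by [A_ind]. *)
Lemma Q2A_submod_closed (M : lmodType Q2A) (S : {pred M}) :
  0 \in S -> {in S &, forall v w, v + w \in S} ->
  (forall c : C, {in S, forall v, c%:A *: v \in S}) ->
  {in S, forall v, K *: v \in S} ->
  (forall s, {in S, forall v, f s *: v \in S}) ->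
  submod_closed S.
Proof.
move=> S0 SD SC SK Sf.
pose T : {pred Q2A} := fun a => `[< {in S, forall v, a *: v \in S} >].
have TP a : reflect {in S, forall v, a *: v \in S} (a \in T) by exact: asboolP.
have TA : forall a, a \in T.
  apply: A_ind; first split.
  - by apply/TP => v Sv; rewrite scale1r.
  - move=> c a b /TP Ta /TP Tb; apply/TP => v Sv.
    rewrite scalerDl SD ?Tb // -mulr_algl -scalerA; exact/SC/Ta.
  - by move=> a b /TP Ta /TP Tb; apply/TP => v Sv; rewrite -scalerA Ta ?Tb.
  - exact/TP.
  - by move=> s; apply/TP/Sf.
by split=> // a v w Sv Sw; rewrite SD //; apply/TP.
Qed.

Lemma restrict_linear (M N : lmodType Q2) (g : M -> N) :
  linear g -> linear (g : restrict M -> restrict N).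
Proof. by move=> gL a v w; apply: gL. Qed.

Lemma alg_scale_eq0 (M : lmodType Q2A) (c : C) (v : M) :
  (c%:A *: v == 0) = (c == 0) || (v == 0).
Proof.
have [->|c0] := eqVneq c 0; first by rewrite !scale0r eqxx.
apply/eqP/eqP => [cv0|->]; last by rewrite scaler0.
rewrite -[v]scale1r -[1]scale1r -(mulVf c0) -scalerA -mulr_algl -scalerA.
by rewrite cv0 scaler0.
Qed.

End Generators.

(** * An explicit four-dimensional module *)

Section ModelModule.
Variable R : realType.
Local Notation C := R[i].

(* [(x0, x1, x2, x3)] stands for x0 v + x1 f_1^+ v + x2 f_1^- v
   + x3 f_1^+ f_1^- v, where K v = v and f_2^+- v = 0. *)
Definition model : lmodType C := (C^o * C^o * C^o * C^o)%type.

Lemma model_opp (a b c d : C^o) :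
  - ((a, b, c, d) : model) = (- a, - b, - c, - d).
Proof. by []. Qed.
Lemma model_add (a b c d a' b' c' d' : C^o) :
  ((a, b, c, d) : model) + (a', b', c', d') = (a + a', b + b', c + c', d + d').
Proof. by []. Qed.

Definition model_act (g : gen) (x : model) : model :=
  let: (x0, x1, x2, x3) := x in
  match g with
  | GenK => (x0, - x1, - x2, x3)
  | Genf i s =>
      if i == 0 then if s then (0, x0, 0, x2) else (0, 0, x0, - x1) else 0
  end.

Lemma model_act_linear g : linear (model_act g).
Proof.
move=> c [[[x0 x1] x2] x3] [[[y0 y1] y2] y3].
have LE (a b d e a' b' d' e' : C^o) :
    c *: ((a, b, d, e) : model) + (a', b', d', e') =
    (c *: a + a', c *: b + b', c *: d + d', c *: e + e') by [].
case: g => [|i s] /=.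
  by rewrite LE !scalerN -!opprD.
case: (i == 0); last by rewrite scaler0 addr0.
by case: s; rewrite LE ?scalerN -?opprD !scaler0 !addr0.
Qed.
HB.instance Definition _ g :=
  GRing.isLinear.Build C model model *:%R (model_act g) (model_act_linear g).

Lemma model_respects : respects (fun g => model_act g : {linear model -> model}).
Proof.
(* [K] squares to the identity on the model, so [e_1] acts as zero and all fermions have to
   anticommute. *)
have e0 : act (fun g => model_act g : {linear model -> model}) (te1 R) =1 fun=> 0.
  move=> [[[x0 x1] x2] x3] /=; rewrite !opprK.
  by rewrite scale1r scaleN1r subrr scaler0.
pose fop i s : {linear model -> model} := model_act (Genf i s).
have fop0 i s x : i != 0 -> fop i s x = 0.
  by case: x => [[[x0 x1] x2] x3] /negPf i0; rewrite /fop /= i0.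
move=> s t [i a|i j|i j a|] x.
- case: x => [[[x0 x1] x2] x3] /=; rewrite scaleN1r.
  by case: (i == 0); case: a => //=; rewrite model_opp !(oppr0, opprK).
- rewrite -[RHS]/(_ *: act _ (te1 R) x) e0 scaler0.
  rewrite -[LHS]/(fop i true (fop j false x) + fop j false (fop i true x)).
  have [->|i0] := eqVneq i 0; last by rewrite !(fop0 i) // linear0 addr0.
  have [->|j0] := eqVneq j 0; last by rewrite !(fop0 j) // linear0 addr0.
  by case: x => [[[x0 x1] x2] x3]; rewrite model_add !addr0 subrr.
- rewrite /= scale0r.
  rewrite -[LHS]/(fop i a (fop j a x) + fop j a (fop i a x)).
  have [->|i0] := eqVneq i 0; last by rewrite !(fop0 i) // linear0 addr0.
  have [->|j0] := eqVneq j 0; last by rewrite !(fop0 j) // linear0 addr0.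
  by case: x a => [[[x0 x1] x2] x3] []; rewrite model_add !(oppr0, addr0).
- by case: x => [[[x0 x1] x2] x3] /=; rewrite !opprK scale1r.
Qed.

End ModelModule.

(** * Structure of the projective cover *)

Section Cover.
Variable R : realType.
Local Notation C := R[i].
Local Notation Q2 := (Q2 R).
Local Notation Q2A := (Q2A R).
Local Notation K := (A_K R).
Local Notation f := (A_f1 R).

Lemma A_triv_alg (c : C) (y : A_triv R) : c%:A *: y = (c * y : C^o).
Proof.
change ((c%:A : Q2) *: (y : Q2_triv R) = (c * y : C^o)).
by rewrite -cls_cst scale_cls.
Qed.

Lemma A_triv_K (y : A_triv R) : K *: y = y.
Proof. exact: (@scale_cls _ _ (Gen R GenK) (y : Q2_triv R)). Qed.

Lemma alg_scaleA (M : lmodType Q2A) (c d : C) (v : M) :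
  c%:A *: (d%:A *: v) = (c * d)%:A *: v.
Proof. by rewrite !scalerA mulr_algl scalerA. Qed.

Lemma alg_scaleC (M : lmodType Q2A) (c : C) (a : Q2A) (v : M) :
  a *: (c%:A *: v) = c%:A *: (a *: v).
Proof. by rewrite !scalerA mulr_algl mulr_algr. Qed.

Lemma scale_fK (M : lmodType Q2A) s (v : M) : f s *: (K *: v) = - (K *: (f s *: v)).
Proof. by rewrite !scalerA A_fK scaleNr. Qed.

Lemma scale_ff (M : lmodType Q2A) s (v : M) : f s *: (f s *: v) = 0.
Proof.
have := A_ff R s s; rewrite eqxx scale0r -mulr2n -scaler_nat => /eqP.
by rewrite scaler_eq0 pnatr_eq0 /= scalerA => /eqP ->; rewrite scale0r.
Qed.

Variables (P : lmodType Q2A) (p : {linear P -> A_triv R}).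
Hypothesis cov : projective_cover p.

(** [A_e1] is half of [1 - K^2], and it annihilates [P] by [cover_e1]. *)
Lemma cover_KK (v : P) : K *: (K *: v) = v.
Proof.
have /eqP := cover_e1 cov v; rewrite /A_e1 -mulr_algl -scalerA alg_scale_eq0.
rewrite invr_eq0 pnatr_eq0 /= scalerBl scale1r expr2 -scalerA subr_eq0.
by move=> /eqP.
Qed.

(** The anticommutator is a scalar multiple of [A_e1], which annihilates [P]. *)
Lemma cover_fC s t (v : P) : f s *: (f t *: v) = - (f t *: (f s *: v)).
Proof.
apply/eqP; rewrite -addr_eq0 !scalerA -scalerDl A_ff.
by rewrite -mulr_algl -scalerA (cover_e1 cov) scaler0.
Qed.

(* The image of a lift of p along the model module has coefficient p v0 = 1 at
   v, and this is the coefficient of f_1^+ f_1^- v after applying f_1^+ f_1^-. *)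
Lemma cover_generator : exists v0 : P,
  [/\ K *: v0 = v0, f true *: (f false *: v0) != 0 &
      forall S : {pred P}, submod_closed S -> v0 \in S -> forall v, v \in S].
Proof.
have [Pproj psurj small] := cov.
(* [K] acts as the identity on the trivial module, so [v + K *: v] has image [1]; it is fixed by [K]
   because [K^2 = 1] on [P]. *)
have [v pv] := psurj (2^-1 : C^o).
pose v0 := v + K *: v.
have pv0 : p v0 = (1 : C^o).
  rewrite linearD linearZ /= A_triv_K pv.
  change (2^-1 + 2^-1 = 1 :> C).
  by field.
exists v0; split.
- by rewrite scalerDr cover_KK addrC.
- pose X := Q2_module (Q2Repr (@model_respects R)).
  pose g0 (x : X) : Q2_triv R := x.1.1.1.
  have g0L : linear g0.
    apply: Q2_morphism_linear => [||x|i s x].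
    - by move=> [[[x0 x1] x2] x3] [[[y0 y1] y2] y3].
    - by move=> c x; rewrite -cls_cst !scale_cls.
    - by rewrite !scale_cls; case: x => [[[x0 x1] x2] x3].
    - rewrite !scale_cls; case: x => [[[x0 x1] x2] x3] /=.
      by case: (i == 0); case: s.
  have [g gE] := linear_bundle (restrict_linear g0L).
  have [|h hp] := Pproj _ _ g p.
    by move=> y; exists ((y : C^o), 0, 0, 0); rewrite gE.
  have fE s (x : restrict X) : f s *: x = model_act (Genf 0 s) x.
    exact: (@scale_cls _ _ (Gen R (Genf 0 s)) (x : X)).
  have hv0 : g0 (h v0) = (1 : C^o) by rewrite -pv0 -hp gE.
  apply/eqP => /(congr1 h); rewrite linear0 !linearZ /= !fE.
  case: (h v0) hv0 => [[[x0 x1] x2] x3]; rewrite /g0 /= => ->.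
  by move/(congr1 snd) => /= /eqP; rewrite oner_eq0.
move=> S Ssub Sv0; apply: small => // x.
have [S0 SL] := Ssub.
exists ((p x : C)%:A *: v0); first by rewrite -[X in X \in _]addr0 SL.
apply/eqP; rewrite linearB subr_eq0 linearZ /= pv0 A_triv_alg mulr1.
by [].
Qed.

(** * The operators through which [f_2] acts, and the odd part of the cover *)

Local Notation F a b := (a *: f false + b *: f true).

Lemma scale_FE (M : lmodType Q2A) a b (v : M) :
  F a b *: v = a%:A *: (f false *: v) + b%:A *: (f true *: v).
Proof. by rewrite scalerDl !scalerA !mulr_algl. Qed.

(** With [cover_FK], this gives [F a b] the commutation rules that [f_2] satisfies against [A], so
    that agreement at the generator will spread to [P]. *)
Lemma cover_FC a b s (v : P) : F a b *: (f s *: v) = - (f s *: (F a b *: v)).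
Proof.
rewrite !scale_FE scalerDr !alg_scaleC opprD.
by rewrite (cover_fC false s) (cover_fC true s) !scalerN.
Qed.

Lemma cover_FK a b (v : P) : F a b *: (K *: v) = - (K *: (F a b *: v)).
Proof.
by rewrite !scale_FE scalerDr !alg_scaleC opprD !scale_fK !scalerN.
Qed.

(** The span of [v0], [f_1^+ f_1^- v0] (even) and [f_1^- v0], [f_1^+ v0] (odd) is a submodule
    containing the generator, hence all of [P]; a vector negated by [K] equals its odd part. *)
Lemma cover_odd (v0 : P) : K *: v0 = v0 ->
  (forall S : {pred P}, submod_closed S -> v0 \in S -> forall v, v \in S) ->
  forall w, K *: w = - w -> exists a b : C, w = F a b *: v0.
Proof.
move=> Kv0 v0gen.
pose u a b c d : P :=
  a%:A *: v0 + d%:A *: (f true *: (f false *: v0)) + F b c *: v0.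
pose S : {pred P} := fun w => `[< exists a b c d, w = u a b c d >].
have SP w : reflect (exists a b c d, w = u a b c d) (w \in S) by exact: asboolP.
(* [K] fixes the even part and negates the odd part, which amounts to subtracting the odd part
   twice. *)
have Ku a b c d : K *: u a b c d = u a b c d - (F b c *: v0 + F b c *: v0).
  have Kf s (v : P) : K *: (f s *: v) = - (f s *: (K *: v)) by rewrite scale_fK opprK.
  have KF : K *: (F b c *: v0) = - (F b c *: v0) by rewrite -{2}Kv0 cover_FK opprK.
  rewrite /u scalerDr KF opprD addrA addrK !scalerDr !alg_scaleC !Kf Kv0.
  by rewrite !scalerN opprK.
have uS : forall w, w \in S.
  apply: v0gen; last first.
    by apply/SP; exists 1, 0, 0, 0; rewrite /u scale_FE !scale1r !scale0r !addr0.
  apply: Q2A_submod_closed.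
  - by apply/SP; exists 0, 0, 0, 0; rewrite /u scale_FE !scale0r !addr0.
  - move=> _ _ /SP[a [b [c [d ->]]]] /SP[a' [b' [c' [d' ->]]]].
    apply/SP; exists (a + a'), (b + b'), (c + c'), (d + d').
    rewrite /u !scale_FE [(a + a')%:A]scalerDl [(b + b')%:A]scalerDl.
    rewrite [(c + c')%:A]scalerDl [(d + d')%:A]scalerDl !(scalerDl v0).
    by rewrite !scalerDl addrACA; congr (_ + _); apply: addrACA.
  - move=> e _ /SP[a [b [c [d ->]]]]; apply/SP.
    exists (e * a), (e * b), (e * c), (e * d).
    by rewrite /u !scale_FE !scalerDr !alg_scaleA.
  - move=> _ /SP[a [b [c [d ->]]]]; apply/SP; exists a, (- b), (- c), d.
    rewrite Ku /u -addrA opprD addNKr; congr (_ + _).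
    by rewrite !scale_FE !scaleNr opprD.
  (* Squares of fermions vanish: [f_1^+] leaves only the terms in [a] and [b], and [f_1^-] only
     those in [a] and [c], the latter with a sign from reordering. *)
  - move=> [] _ /SP[a [b [c [d ->]]]]; apply/SP.
      exists 0, 0, a, b; rewrite /u !scale_FE !scalerDr !alg_scaleC !scale_ff.
      by rewrite !(scaler0, scale0r, addr0, add0r) addrC.
    exists 0, a, 0, (- c); rewrite /u !scale_FE !scalerDr !alg_scaleC.
    rewrite (cover_fC false true) !scale_ff !(scaler0, oppr0, scale0r, addr0, add0r).
    by rewrite (cover_fC false true) scalerN !scaleNr addrC.
move=> w Kw; have /SP[a [b [c [d wE]]]] := uS w; exists b, c.
(* [K *: w = - w] and [Ku] give [2 w = 2 F b c v0]. *)
have /eqP : (1 + 1)%:A *: (w - F b c *: v0) = 0.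
  rewrite scalerDl scalerDl !scale1r addrACA -opprD.
  by rewrite -[X in w + X - _]opprK -Kw {2}wE Ku -wE opprB addrCA subrr addr0 subrr.
by rewrite alg_scale_eq0 (pnatr_eq0 _ 2) subr_eq0 => /eqP.
Qed.

(** * Classification of the lifts *)

Lemma lift_Pmu (N : lmodType Q2) :
  is_lift P N -> exists mu : 'M[C]_2, isomorphic N (Pmu cov mu).
Proof.
move=> [phi phi_bij]; have [psi phiK psiK] := phi_bij.
have [v0 [Kv0 _ v0gen]] := cover_generator.
have phiA a (n : N) : phi (A_val a *: n) = a *: phi n.
  exact: (linearZZ phi a (n : restrict N)).
have psiA a v : psi (a *: v) = A_val a *: (psi v : N).
  by apply: (can_inj phiK); rewrite phiA !psiK.
have psiD v w : psi (v + w) = psi v + psi w.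
  by apply: (can_inj phiK); rewrite linearD !psiK.
(* The indices [1] and [0] differ, so the term in [e_1] has coefficient zero. *)
have f2A s t (n : N) : Q2_f R 1 s *: (A_val (f t) *: n) =
    - (A_val (f t) *: (Q2_f R 1 s *: n)).
  apply/eqP; rewrite -addr_eq0 !scalerA -scalerDl.
  have [<-|] := eqVneq s t; first by rewrite Q2_ff scale0r.
  case: s t => [] [] // _; first by rewrite Q2_fpm !scale0r.
  by rewrite addrC Q2_fpm !scale0r.
have f2K s (n : N) : Q2_f R 1 s *: (Q2_K R *: n) =
    - (Q2_K R *: (Q2_f R 1 s *: n)).
  by rewrite !scalerA Q2_fK scaleNr.
have phi_f2 s : exists a b, forall n : N,
    phi (Q2_f R 1 s *: n) = F a b *: phi n.
  (* [v0] is fixed by [K] and [f_2^s] anticommutes with [K], so the transported vector is odd. *)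
  have [|a [b ab]] := cover_odd Kv0 v0gen (w := phi (Q2_f R 1 s *: (psi v0 : N))).
    rewrite -phiA -[A_val K]/(Q2_K R) -[_ *: (_ *: _)]opprK -f2K linearN.
    by rewrite -[Q2_K R]/(A_val K) -psiA Kv0.
  exists a, b => n.
  (* The set where the transported [f_2^s] and [F a b] agree is a submodule containing the
     generator. *)
  pose S : {pred P} :=
    [pred w | phi (Q2_f R 1 s *: (psi w : N)) == F a b *: w].
  suff /(_ (phi n)) : forall w, w \in S by rewrite inE phiK => /eqP.
  apply: v0gen; last by rewrite inE ab.
  apply: Q2A_submod_closed.
  - rewrite inE scaler0 (_ : psi 0 = 0); last first.
      by apply: (can_inj phiK); rewrite psiK linear0.
    by rewrite scaler0; apply/eqP; apply: linear0.
  - move=> v w /eqP vS /eqP wS; rewrite inE psiD !scalerDr -vS -wS.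
    by apply/eqP; apply: linearD.
  - move=> c v /eqP vS; rewrite inE psiA alg_scaleC -vS -phiA.
    by rewrite !scalerA mulr_algl mulr_algr.
  - move=> v /eqP vS; rewrite inE psiA f2K cover_FK -vS -phiA.
    by apply/eqP; apply: linearN.
  - move=> t v /eqP vS; rewrite inE psiA f2A cover_FC -vS -phiA.
    by apply/eqP; apply: linearN.
have [a0 [b0 phi0]] := phi_f2 false; have [a1 [b1 phi1]] := phi_f2 true.
(* Columns follow [sign_col], minus first; rows hold the coefficients of [f_1^-] and [f_1^+]. *)
pose mu : 'M[C]_2 := \matrix_(i, j)
  if i == 0 then (if j == 0 then a0 else a1) else (if j == 0 then b0 else b1).
exists mu.
have phiL : linear (phi : N -> Pmu cov mu).
  apply: Q2_morphism_linear => [v w|c v|v|i s v].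
  - exact: linearD.
  - by rewrite [RHS](@Pmu_A _ _ _ cov mu c%:A) -phiA.
  - by rewrite [RHS](@Pmu_A _ _ _ cov mu (A_K R)) -phiA.
  - have [->|i0] := eqVneq i 0.
      by rewrite [RHS](@Pmu_A _ _ _ cov mu (f s)) -phiA.
    have -> : i = 1 by case: i i0 => [[|[|//]] //] ? _; apply: val_inj.
    rewrite [RHS]Pmu_f2 /mu !mxE /=; by case: s; [apply: phi1|apply: phi0].
have [h hE] := linear_bundle phiL.
by exists h; rewrite hE; exact: phi_bij.
Qed.

Lemma Pmu_inj (mu mu' : 'M[C]_2) :
  isomorphic (Pmu cov mu) (Pmu cov mu') -> mu = mu'.
Proof.
move=> [phi phi_bij].
have [v0 [_ v0neq0 _]] := cover_generator.
have phiA a (v : P) : phi (a *: v) = a *: (phi v : P) :> P.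
  by rewrite -(@Pmu_A _ _ _ cov mu a) linearZ /= [LHS](@Pmu_A _ _ _ cov mu' a).
have phif2 s : (mu 0 (sign_col s) *: f false + mu 1 (sign_col s) *: f true) *: v0
    = (mu' 0 (sign_col s) *: f false + mu' 1 (sign_col s) *: f true) *: v0.
  (* Both sides map to [f_2^s] applied to [phi v0]: the left as the image of [f_2^s v0], the right
     because [phi] commutes with [A]. *)
  apply: (bij_inj phi_bij); rewrite -(@Pmu_f2 _ _ _ cov mu) [RHS]phiA.
  by rewrite -(@Pmu_f2 _ _ _ cov mu') linearZ.
have Finj a b a' b' : F a b *: v0 = F a' b' *: v0 -> a = a' /\ b = b'.
  move=> FF; have {}FF : F (a - a') (b - b') *: v0 = 0.
    rewrite scale_FE [(a - a')%:A]scalerBl [(b - b')%:A]scalerBl !scalerBl.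
    by rewrite addrACA -opprD -!scale_FE FF subrr.
  (* Applying [f_1^+] isolates [a - a'], and [f_1^-] isolates [b - b'] up to sign, each as the
     coefficient of the nonzero vector [f_1^+ f_1^- v0]. *)
  move: v0neq0 (congr1 ( *:%R (f true)) FF) (congr1 ( *:%R (f false)) FF).
  rewrite scaler0 scale_FE !scalerDr !alg_scaleC !scale_ff !scaler0 addr0 add0r.
  rewrite (cover_fC false true) scalerN => fneq0 /eqP.
  rewrite alg_scale_eq0 (negPf fneq0) orbF subr_eq0 => /eqP -> /eqP.
  by rewrite oppr_eq0 alg_scale_eq0 (negPf fneq0) orbF subr_eq0 => /eqP ->.
have muE s i : mu i (sign_col s) = mu' i (sign_col s).
  have [mu0 mu1] := Finj _ _ _ _ (phif2 s).
  by case: i => [[|[|//]] ilt]; [move: mu0|move: mu1]; congr (mu _ _ = mu' _ _);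
    apply: val_inj.
apply/matrixP => i j; have -> : j = sign_col (j != 0); last exact: muE.
by case: j => [[|[|//]] jlt]; apply: val_inj.
Qed.

End Cover.

Theorem proposition5p5 (R : realType) (P : lmodType (Q2A R))
    (p : {linear P -> A_triv R}) (cov : projective_cover p) :
  (forall N : lmodType (Q2 R), is_lift P N ->
     exists mu : 'M[R[i]]_2, isomorphic N (Pmu cov mu)) /\
  (forall mu mu' : 'M[R[i]]_2, isomorphic (Pmu cov mu) (Pmu cov mu') <-> mu = mu').
Proof.
split=> [N|mu mu']; first exact: lift_Pmu.
split=> [|<-]; first exact: Pmu_inj.
by exists idfun; exists id.
Qed.
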